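(* Let $\delta>0$, $t_n=n\delta$, and let $X$ solve the ergodic SDE $dX_t=f(X_t)\,dt+\sigma\,dB_t$. Let $\phi_0,\dots,\phi_p:\mathbb{R}^2\to\mathbb{R}$ be basis functions and $F^\delta(c;x,\xi)=\sum_{i=0}^pc_i\phi_i(x,\xi)$ the associated parametric flow map, $c\in\mathbb{R}^{p+1}$. Assume that this parametric form comes from an explicit scheme with flow map $F^\delta(x,\xi)$, that is, there is $c^*\in\mathbb{R}^{p+1}$ with $F^\delta(x,\xi)=F^\delta(c^*;x,\xi)$ (for example, the parametric form of IS-EM or IS-RK4, with explicit scheme flow map $F^\delta_{EM}$ or $F^\delta_{RK4}$ respectively). Suppose: (a) the data $\{(X_{t_0:t_N}^{(m)},B_{t_0:t_N}^{(m)})\}_{m=1}^M$ are independent trajectories of the SDE with $\{X_{t_0}^{(m)}\}_{m=1}^M$ sampled from the ergodic measure of $X$; (b) the normal matrix $\bar A^{N,M}$ and its expectation $A=\mathbb{E}[\bar A^{N,M}]$ are invertible; (c) the flow map $(X_{t_{n+1}}-X_{t_n})/\delta$ is square integrable. Then the residual of the inferred scheme is not larger than that of the explicit scheme: $$\mathbb{E}\big[\widehat{(\sigma^{N,M})^2}\big]\le\frac2d\,\mathbb{E}\Big[\Big|\frac{X_{t_{n+1}}-X_{t_n}}{\delta}-F^\delta(X_{t_n},\Delta B_{t_n})\Big|^2\Big],$$ where $d=1$ and $$\widehat{(\sigma^{N,M})^2}=\frac{2}{d\,\delta^2}\,\frac1{MN}\sum_{m=1}^M\sum_{n=0}^{N-1}\Big|X_{t_{n+1}}^{(m)}-X_{t_n}^{(m)}-\delta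 F^\delta\big(\widehat{c^{\delta,N,M}};X_{t_n}^{(m)},\Delta B_{t_n}^{(m)}\big)\Big|^2 .$$ In other words, the inferred scheme has the same 1-step strong order as the explicit scheme it parametrizes: any bound $O(\delta^{r})$ as $\delta\to0$ for the mean square 1-step error $\mathbb{E}[|\frac{X_{t_{n+1}}-X_{t_n}}{\delta}-F^\delta(X_{t_n},\Delta B_{t_n})|^2]$ of the explicit scheme also holds for $\mathbb{E}[\widehat{(\sigma^{N,M})^2}]$.
   Context: Standing conventions: the state dimension is $d=1$; $B$ is a standard one-dimensional Brownian motion; the drift $f:\mathbb{R}\to\mathbb{R}$ is locally Lipschitz and $\sigma\neq0$ is constant; the SDE is ergodic with invariant (ergodic) probability measure $\mu$. $\Delta B_{t_n}=B_{t_{n+1}}-B_{t_n}\sim\mathcal N(0,\delta)$. The basis functions, hence also the explicit flow map, are square integrable under $\mu\otimes\mathcal N(0,\delta)$. Since $X_{t_0}\sim\mu$, the sequence $(X_{t_n},\Delta B_{t_n})$ is stationary, so the right-hand side of the inequality does not depend on $n$. The least squares estimator is $\widehat{c^{\delta,N,M}}=(\bar A^{N,M})^{+}\,\bar b^{N,M}$ ($^{+}$ is the pseudo-inverse), where for $i,j=0,\dots,p$ $$\bar A^{N,M}(i,j)=\frac1{MN}\sum_{m=1}^M\sum_{n=0}^{N-1}\phi_i(X_{t_n}^{(m)},\Delta B_{t_n}^{(m)})\,\phi_j(X_{t_n}^{(m)},\Delta B_{t_n}^{(m)}),$$ $$\bar b^{N,M}(i)=\frac1{MN}\sum_{m=1}^M\sum_{n=0}^{N-1}\frac{X_{t_{n+1}}^{(m)}-X_{t_n}^{(m)}}{\delta}\,\phi_i(X_{t_n}^{(m)},\Delta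 B_{t_n}^{(m)}).$$ The inferred scheme is $$X_{n+1}=X_n+\delta F^\delta(\widehat{c^{\delta,N,M}};X_n,\xi_n)+\delta\sigma_\eta\eta_n,$$ with $\xi_n$ distributed as $\Delta B_{t_n}$ and $\sigma_\eta\eta_n$ representing the regression residual. An explicit scheme with flow map $F^\delta$ is $X_{n+1}=X_n+\delta F^\delta(X_n,\Delta B_n)$. Examples: - Euler–Maruyama: $F^\delta_{EM}(x,\xi)=f(x)+\sigma\xi/\delta$. Its parametrization (IS-EM) is $c_0x+c_1f(x)+c_2\sigma\xi/\delta$. - Hybrid RK4: $F^\delta_{RK4}(x,\xi)=\phi_1(x,\sigma\xi)+\sigma\xi/\delta$. Its parametrization (IS-RK4) is $c_0x+c_1\phi_1(x,\sigma\xi)+c_2\sigma\xi/\delta$. Here $\phi_1(x,\sigma\xi)=(k_1+2k_2+2k_3+k_4)/6$ with $k_1=f(x)+\sigma\xi/\delta$, $k_2=f(x+k_1\delta/2)+\sigma\xi/\delta$, $k_3=f(x+k_2\delta/2)+\sigma\xi/\delta$, $k_4=f(x+k_3\delta/2)+\sigma\xi/\delta$. In both cases $c^*=(0,1,1)$. *)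

(* Defs.v *)
From HB Require Import structures.
From mathcomp Require Import all_boot all_order all_algebra.
From mathcomp Require Import all_classical all_reals all_analysis.

Set Implicit Arguments.
Unset Strict Implicit.
Unset Printing Implicit Defensive.

Import Order.TTheory GRing.Theory Num.Theory.
Import numFieldNormedType.Exports.

Local Open Scope classical_set_scope.
Local Open Scope ring_scope.

Section laws_and_independence.
Context {R : realType} {d : measure_display} {Omega : measurableType d}.
Variable P : probability Omega R.

Definition has_law (Y : Omega -> R) (nu : set R -> \bar R) : Prop :=
  measurable_fun setT Y /\
  forall U : set R, measurable U -> P (Y @^-1` U) = nu U.

Definition mutually_independent (I : finType) (G : I -> set (set Omega)) : Prop :=
  forall (J : {set I}) (E : I -> set Omega),
    (forall i, i \in J -> G i (E i)) ->
    P (\bigcap_(i in [set i | i \in J]) E i) = (\prod_(i in J) P (E i))%E.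

End laws_and_independence.

Section sde.
Context {R : realType} {d : measure_display} {Omega : measurableType d}.
Variable P : probability Omega R.

(* Processes are functions R -> Omega -> R of which only the times t >= 0
   are meaningful. *)
Record filtration (Fil : R -> set (set Omega)) : Prop := {
  filtration_sigma : forall t : R, 0 <= t -> sigma_algebra setT (Fil t) ;
  filtration_measurable : forall t : R, 0 <= t -> Fil t `<=` measurable ;
  filtration_mono : forall s t : R, 0 <= s -> s <= t -> Fil s `<=` Fil t }.

Definition adapted (Fil : R -> set (set Omega)) (Y : R -> Omega -> R) : Prop :=
  forall t : R, 0 <= t -> forall U : set R, measurable U -> Fil t (Y t @^-1` U).

Definition continuous_paths (Y : R -> Omega -> R) : Prop :=
  {ae P, forall w, {within `[0, +oo[, continuous (fun t : R => Y t w)}}.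

(* normal_prob takes the standard deviation, and normal_prob 0 0 is not a
   Dirac mass, hence s < t in the law of the increments. *)
Record brownian_motion (Fil : R -> set (set Omega)) (B : R -> Omega -> R)
    : Prop := {
  bm_adapted : adapted Fil B ;
  bm_start : {ae P, forall w, B 0 w = 0} ;
  bm_law : forall s t : R, 0 <= s -> s < t ->
    has_law P (fun w => (B t w - B s w)%R) (normal_prob 0 (Num.sqrt (t - s))) ;
  bm_indep : forall s t : R, 0 <= s -> s <= t ->
    forall (E : set Omega) (U : set R), Fil s E -> measurable U ->
    P (E `&` (fun w => (B t w - B s w)%R) @^-1` U) =
    (P E * P ((fun w => (B t w - B s w)%R) @^-1` U))%E ;
  bm_continuous : continuous_paths B }.

(* dX_t = f(X_t) dt + sigma dB_t on [0, +oo[.  The noise being additive, the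
   stochastic integral of the constant sigma over [0, t] is sigma * B t. *)
Definition sde_solution (f : R -> R) (sigma : R) (X B : R -> Omega -> R)
    : Prop :=
  exists Fil : R -> set (set Omega),
    [/\ filtration Fil, brownian_motion Fil B, adapted Fil X,
        continuous_paths X &
        {ae P, forall w, forall t : R, 0 <= t ->
          X t w = X 0 w
                  + \int[lebesgue_measure]_(s in `[0, t]) f (X s w)
                  + sigma * B t w}].

End sde.

(* mu is an invariant probability measure of the SDE and time averages along
   the stationary solutions converge to the space averages.  The solutions
   range over all probability spaces, so that this is a property of
   (f, sigma, mu) alone. *)
Record ergodic_measure {R : realType} (f : R -> R) (sigma : R)
    (mu : probability (measurableTypeR R) R) : Prop := {
  ergodic_exists :
    exists (d : measure_display) (Omega : measurableType d)
           (P : probability Omega R) (X B : R -> Omega -> R),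
      sde_solution P f sigma X B /\ has_law P (X 0) mu ;
  ergodic_invariant :
    forall (d : measure_display) (Omega : measurableType d)
           (P : probability Omega R) (X B : R -> Omega -> R),
      sde_solution P f sigma X B -> has_law P (X 0) mu ->
      forall t : R, 0 <= t -> has_law P (X t) mu ;
  ergodic_average :
    forall (d : measure_display) (Omega : measurableType d)
           (P : probability Omega R) (X B : R -> Omega -> R),
      sde_solution P f sigma X B -> has_law P (X 0) mu ->
      forall g : R -> R, mu.-integrable setT (EFin \o g) ->
      {ae P, forall w,
        (T^-1 * \int[lebesgue_measure]_(s in `[0, T]) g (X s w))
          @[T --> +oo] --> \int[mu]_x g x} }.

Section inferred_scheme.
Context {R : realType}.

Definition is_pseudo_inverse m n (A : 'M[R]_(m, n)) (G : 'M[R]_(n, m)) : Prop :=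
  [/\ A *m G *m A = A, G *m A *m G = G,
      (A *m G)^T = A *m G & (G *m A)^T = G *m A].

(* The Moore-Penrose conditions have exactly one solution over R. *)
Definition pseudo_inverse m n (A : 'M[R]_(m, n)) : 'M[R]_(n, m) :=
  xget 0 [set G | is_pseudo_inverse A G].

Context {p : nat}.
Variable phi : 'I_p.+1 -> R -> R -> R.

Definition param_flow (c : 'cV[R]_p.+1) (x xi : R) : R :=
  \sum_(i < p.+1) c i 0 * phi i x xi.

Definition parametrizes (F : R -> R -> R) : Prop :=
  exists c : 'cV[R]_p.+1, forall x xi, F x xi = param_flow c x xi.

(* x m n and b m n are the values at time t_n of the m-th data trajectory and
   of its driving noise; incr (b m) n is the noise increment over
   [t_n, t_(n+1)]. *)
Definition incr (y : nat -> R) (n : nat) : R := y n.+1 - y n.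

Variables (delta : R) (N M : nat) (x b : 'I_M -> nat -> R).

Definition normal_matrix : 'M[R]_p.+1 :=
  \matrix_(i, j) ((M * N)%:R^-1 * \sum_(m < M) \sum_(n < N)
    phi i (x m n) (incr (b m) n) * phi j (x m n) (incr (b m) n)).

Definition normal_vector : 'cV[R]_p.+1 :=
  \col_i ((M * N)%:R^-1 * \sum_(m < M) \sum_(n < N)
    incr (x m) n / delta * phi i (x m n) (incr (b m) n)).

Definition estimator : 'cV[R]_p.+1 :=
  pseudo_inverse normal_matrix *m normal_vector.

(* The state dimension is 1. *)
Definition sigma2_hat : R :=
  2 / delta ^+ 2 * (M * N)%:R^-1 * \sum_(m < M) \sum_(n < N)
    `| incr (x m) n
       - delta * param_flow estimator (x m n) (incr (b m) n) | ^+ 2.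

End inferred_scheme.

Section setting.
Context {R : realType} {d : measure_display} {Omega : measurableType d}.
Variable P : probability Omega R.

Definition sampled (delta : R) (Y : R -> Omega -> R) (w : Omega) (n : nat) : R :=
  Y (n%:R * delta) w.

Definition sampled_family (delta : R) (I : Type) (Y : I -> R -> Omega -> R)
    (w : Omega) (i : I) (n : nat) : R := sampled delta (Y i) w n.

(* The sigma-algebra generated by (X_{t_0:t_N}, B_{t_0:t_N}). *)
Definition sigma_data (delta : R) (N : nat) (X B : R -> Omega -> R)
    : set (set Omega) :=
  <<s [set E | exists k : nat, exists U : set R,
        [/\ (k <= N)%N, measurable U &
            E = X (k%:R * delta) @^-1` U \/ E = B (k%:R * delta) @^-1` U] ] >>.

(* The mean square 1-step error of the scheme with flow map F at time t_n. *)
Definition one_step_mse (delta : R) (F : R -> R -> R) (X B : R -> Omega -> R)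
    (n : nat) : \bar R :=
  'E_P[fun w => `| incr (sampled delta X w) n / delta
                   - F (sampled delta X w n) (incr (sampled delta B w) n)
                 | ^+ 2].

Context {p : nat}.

Definition mean_sigma2_hat (phi : 'I_p.+1 -> R -> R -> R) (delta : R)
    (N M : nat) (Xs Bs : 'I_M -> R -> Omega -> R) : \bar R :=
  'E_P[fun w => sigma2_hat phi delta N (sampled_family delta Xs w)
                  (sampled_family delta Bs w)].

Definition data_normal_matrix (phi : 'I_p.+1 -> R -> R -> R) (delta : R)
    (N M : nat) (Xs Bs : 'I_M -> R -> Omega -> R) (w : Omega) : 'M[R]_p.+1 :=
  normal_matrix phi N (sampled_family delta Xs w) (sampled_family delta Bs w).

Definition mean_normal_matrix (phi : 'I_p.+1 -> R -> R -> R) (delta : R)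
    (N M : nat) (Xs Bs : 'I_M -> R -> Omega -> R) : 'M[R]_p.+1 :=
  \matrix_(i, j) fine 'E_P[fun w => data_normal_matrix phi delta N Xs Bs w i j].

Record inference_setting (f : R -> R) (sigma : R)
    (mu : probability (measurableTypeR R) R) (X : R -> Omega -> R) (delta : R)
    (phi : 'I_p.+1 -> R -> R -> R) (F : R -> R -> R)
    (N M : nat) (Xs Bs : 'I_M -> R -> Omega -> R) : Prop := {
  setting_delta : 0 < delta ;
  setting_sizes : (0 < N)%N /\ (0 < M)%N ;
  setting_basis : forall i,
    (fun z : R * R => phi i z.1 z.2) \in
      Lfun (mu \x normal_prob 0 (Num.sqrt delta))%E 2%:E ;
  setting_scheme : parametrizes phi F ;
  setting_solutions : forall m, sde_solution P f sigma (Xs m) (Bs m) ;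
  setting_initial : forall m, has_law P (Xs m 0) mu ;
  setting_independent :
    mutually_independent P (fun m => sigma_data delta N (Xs m) (Bs m)) ;
  setting_unit :
    {ae P, forall w, data_normal_matrix phi delta N Xs Bs w \in unitmx} ;
  setting_mean_unit : mean_normal_matrix phi delta N Xs Bs \in unitmx ;
  setting_square_integrable : forall n,
    (fun w => incr (sampled delta X w) n / delta) \in Lfun P 2%:E }.

End setting.

Section examples.
Context {R : realType}.
Variables (f : R -> R) (sigma delta : R).

Definition flow_EM (x xi : R) : R := f x + sigma * xi / delta.

Definition basis_IS_EM (i : 'I_3) (x xi : R) : R :=
  [:: x; f x; sigma * xi / delta]`_i.

Definition RK4_term (x s : R) : R :=
  let k1 := f x + s / delta in
  let k2 := f (x + k1 * delta / 2) + s / delta in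
  let k3 := f (x + k2 * delta / 2) + s / delta in
  let k4 := f (x + k3 * delta / 2) + s / delta in
  (k1 + 2 * k2 + 2 * k3 + k4) / 6.

Definition flow_RK4 (x xi : R) : R :=
  RK4_term x (sigma * xi) + sigma * xi / delta.

Definition basis_IS_RK4 (i : 'I_3) (x xi : R) : R :=
  [:: x; RK4_term x (sigma * xi); sigma * xi / delta]`_i.

Lemma IS_EM_parametrizes : parametrizes basis_IS_EM flow_EM.
Proof.
exists (\col_i [:: 0; 1; 1]`_i) => x xi.
rewrite /param_flow !big_ord_recl big_ord0 !mxE /basis_IS_EM /flow_EM /=.
by rewrite mul0r !mul1r add0r addr0.
Qed.

Lemma IS_RK4_parametrizes : parametrizes basis_IS_RK4 flow_RK4.
Proof.
exists (\col_i [:: 0; 1; 1]`_i) => x xi.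
rewrite /param_flow !big_ord_recl big_ord0 !mxE /basis_IS_RK4 /flow_RK4 /=.
by rewrite mul0r !mul1r add0r addr0.
Qed.

End examples.

(* Main.v *)
(* On the event where the normal matrix is invertible, the estimator minimises
   the empirical quadratic error, so the residual of the inferred scheme is at
   most the empirical error of the parameter c of the explicit scheme, whose
   expectation is an average of mean square 1-step errors along the data.

   These 1-step errors all equal that of (X, B) at time t_n because the law of
   (X_t, X_(t+delta), B_(t+delta) - B_t) depends only on the law of X_t: the
   Euler scheme with k substeps started at X_t is a function of X_t and of k
   independent Gaussian increments, and, f being locally Lipschitz and the paths
   being defined on all of [0, +oo[, it converges pathwise to X_(t+delta) as k
   tends to infinity. *)

Require Import Defs.
From HB Require Import structures.
From mathcomp Require Import all_boot all_order all_algebra.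
From mathcomp Require Import all_classical all_reals all_analysis.
From mathcomp Require Import measurable_realfun ring.
Import Order.TTheory GRing.Theory Num.Theory.
Import numFieldNormedType.Exports.

Local Open Scope classical_set_scope.
Local Open Scope ring_scope.

(** * Local Lipschitz estimates, compactness and a discrete Gronwall inequality *)

Lemma locally_lipschitz_ball {R : realType} (f : R -> R) :
  [locally [lipschitz f x | x in setT]] ->
  forall x0, exists2 e, 0 < e & exists2 L, 0 < L &
    forall y z, `|x0 - y| < e -> `|x0 - z| < e -> `|f y - f z| <= L * `|y - z|.
Proof.
move=> flip x0.
(* At a diagonal point a neighbourhood in the product contains a product of two balls, whence the
   radius [Num.min e1 e2]. *)
have /(_ _)/pinfty_ex_gt0[] := flip (x0, x0) _ => // L L0 /=.
rewrite /within/= /dominated_by.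
move=> [[U V]] /= [/nbhs_ballP[e1 /= e1gt0 U1] /nbhs_ballP[e2 /= e2gt0 V2]] UV.
exists (Num.min e1 e2); first by rewrite lt_min e1gt0.
exists L => // y z; rewrite !lt_min => /andP[y1 _] /andP[_ z2].
apply: (UV (y, z)) => //; split; [exact: U1|exact: V2].
Qed.

Lemma locally_lipschitz_continuous {R : realType} (f : R -> R) :
  [locally [lipschitz f x | x in setT]] -> continuous f.
Proof.
move=> /locally_lipschitz_ball flip x; have [e e0 [L L0 fL]] := flip x.
apply/cvgrPdist_le => eps eps0; near=> y.
have xy : `|x - y| < e by near: y; exact: cvgr_dist_lt.
rewrite (le_trans (fL _ _ _ _))// ?subrr ?normr0//.
rewrite -ler_pdivlMl// mulrC; near: y.
by apply: cvgr_dist_le => //; rewrite divr_gt0.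
Unshelve. all: end_near. Qed.

(** The point [z] may lie outside [K], since the Euler scheme need not stay on the range of the
    path. Using [L] both as Lipschitz constant and as inverse radius leaves a single parameter
    tending to infinity, which is the form required by the near-covering characterisation of
    compactness. *)
Lemma locally_lipschitz_compact {R : realType} (f : R -> R) (K : set R) :
  [locally [lipschitz f x | x in setT]] -> compact K ->
  exists2 L, 0 < L & forall x z, K x -> `|z - x| <= L^-1 ->
    `|f z - f x| <= L * `|z - x|.
Proof.
move=> /locally_lipschitz_ball flip /compact_near_coveringP Kc.
suff /pinfty_ex_gt0[L L0 HL] : \forall L \near +oo, K `<=` [set x | forall z,
    `|z - x| <= L^-1 -> `|f z - f x| <= L * `|z - x|].
  by exists L => // x z /HL; exact.
apply: (Kc _ _ (fun L x => forall z, `|z - x| <= L^-1 ->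
  `|f z - f x| <= L * `|z - x|)) => x Kx.
have [e e0 [L0 L00 fL]] := flip x.
near=> y L => z /= zy.
have L_gt0 : 0 < L by near: L; exact: nbhs_pinfty_gt.
have xy : `|x - y| < e / 2.
  by near: y; apply: cvgr_dist_lt => //; rewrite divr_gt0.
have Le : L^-1 < e / 2.
  rewrite -[ltRHS]invrK ltf_pV2 ?posrE ?invr_gt0 ?divr_gt0//.
  by near: L; apply: nbhs_pinfty_gt; rewrite num_real.
have LL : L0 <= L by near: L; apply: nbhs_pinfty_ge; rewrite num_real.
have xz : `|x - z| < e.
  rewrite [ltRHS]splitr (le_lt_trans (ler_distD y _ _))//.
  by rewrite ltrD// distrC (le_lt_trans zy).
rewrite (le_trans (fL _ _ xz _)) ?ler_wpM2r// (lt_trans xy)//.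
Unshelve. all: end_near. Qed.

(** Heine's theorem, by near-covering with the modulus [eta] tending to 0 from the right as
    parameter. *)
Lemma compact_uniform_continuity {R : realType} (g : R -> R) (K : set R) :
  compact K -> {within K, continuous g} ->
  forall e : R, 0 < e -> exists2 eta, 0 < eta & forall s t, K s -> K t ->
    `|s - t| <= eta -> `|g s - g t| <= e.
Proof.
move=> /compact_near_coveringP/near_covering_withinP Kc gc e e0.
suff : \forall eta \near (0 : R)^'+, K `<=` [set s | forall t, K t ->
    `|s - t| <= eta -> `|g s - g t| <= e].
  move=> near_eta.
  have [eta [gK eta0]] := filter_ex (filterI near_eta (nbhs_right_gt 0)).
  by exists eta => // s t /gK; exact.
apply: (Kc _ _ (fun eta s => forall t, K t -> `|s - t| <= eta ->
    `|g s - g t| <= e)) => s Ks.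
have /cvgrPdist_le/(_ (e / 2)) := (subspace_continuousP _ _).1 gc s Ks.
rewrite divr_gt0// => /(_ isT); rewrite /prop_near1 /within/=.
move=> /nbhs_ballP[r /= r0 sr].
near=> s' eta => /= Ks' t Kt s't.
have ss' : `|s - s'| < r / 2.
  by near: s'; apply: cvgr_dist_lt => //; rewrite divr_gt0.
have er : eta < r / 2 by near: eta; apply: nbhs_right_lt; rewrite divr_gt0.
have sr2 : forall u, K u -> `|s - u| < r -> `|g s - g u| <= e / 2.
  by move=> u Ku su; exact: sr.
have ss'r : `|s - s'| < r.
  by rewrite (lt_trans ss')// ltr_pdivrMr// ltr_pMr ?ltr1n.
have str : `|s - t| < r.
  rewrite [ltRHS]splitr (le_lt_trans (ler_distD s' _ _))//.
  by rewrite ltrD// (le_lt_trans s't).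
rewrite [leRHS]splitr (le_trans (ler_distD (g s) _ _))// lerD ?sr2//.
by rewrite distrC sr2.
Unshelve. all: end_near. Qed.

(** The recursive inequality is available only while [a j <= L^-1]. The final bound is itself at
    most [L^-1] and dominates all earlier ones, so the induction never leaves this range. *)
Lemma discrete_gronwall {R : realType} (a : nat -> R) (h L e : R) (n : nat) :
  0 <= h -> 0 <= L -> 0 <= e -> a 0 <= 0 ->
  e * (n%:R * h) * expR (n%:R * h * L) <= L^-1 ->
  (forall j, (j < n)%N -> a j <= L^-1 -> a j.+1 <= (1 + h * L) * a j + h * e) ->
  forall j, (j <= n)%N -> a j <= e * (j%:R * h) * expR (j%:R * h * L).
Proof.
move=> h0 L0 e0 a0 small step; elim=> [|j IH] jn; first by rewrite !mul0r mulr0 mul0r.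
have {}IH := IH (ltnW jn).
have hL0 : 0 <= h * L by rewrite mulr_ge0.
have aL : a j <= L^-1.
  rewrite (le_trans IH)// (le_trans _ small)// ler_pM ?mulr_ge0 ?expR_ge0//.
    by rewrite ler_wpM2l// ler_wpM2r// ler_nat ltnW.
  by rewrite ler_expR ler_wpM2r// ler_wpM2r// ler_nat ltnW.
rewrite (le_trans (step _ jn aL))//.
have -> : j.+1%:R * h * L = h * L + j%:R * h * L by rewrite -natr1; ring.
rewrite expRD; set E := expR (j%:R * h * L) in IH *.
have E1 : 1 <= E by rewrite -expR0 ler_expR !mulr_ge0.
have hE : 1 + h * L <= expR (h * L) by exact: expR_ge1Dx.
set H := expR (h * L) in hE *.
have H1 : 1 <= H by rewrite (le_trans _ hE)// lerDl.
have HE1 : 1 <= H * E by rewrite (le_trans E1)// ler_peMl// (le_trans _ E1).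
(* The bound at [j.+1] splits into [H] times the bound at [j], which absorbs the factor [1 + h * L],
   and [h * e] times [H * E], which is at least 1 and so absorbs the new error. *)
rewrite (_ : _ * (H * E) = H * (e * (j%:R * h) * E) + h * e * (H * E)); last first.
  by rewrite -natr1; ring.
apply: lerD; last by rewrite ler_peMr// mulr_ge0.
rewrite (@le_trans _ _ ((1 + h * L) * (e * (j%:R * h) * E)))//.
  by rewrite ler_wpM2l// addr_ge0.
by rewrite ler_wpM2r// !mulr_ge0// expR_ge0.
Qed.

(** * Pathwise convergence of the Euler scheme *)

Section solution_path.
Context {R : realType} (f : R -> R) (sigma : R) (x b : R -> R).
Hypothesis fc : continuous f.
Hypothesis xc : {within `[0, +oo[, continuous x}.
Hypothesis xE : forall t, 0 <= t ->
  x t = x 0 + \int[lebesgue_measure]_(s in `[0, t]) f (x s) + sigma * b t.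

Lemma solution_path_continuous s t : 0 <= s -> {within `[s, t], continuous x}.
Proof.
move=> s0; apply: continuous_subspaceW xc => u /=.
by rewrite !in_itv/= andbT => /andP[su _]; exact: le_trans su.
Qed.

Lemma drift_path_continuous s t : 0 <= s ->
  {within `[s, t], continuous (f \o x)}.
Proof.
move=> s0 u; apply: (@continuous_comp (subspace `[s, t]) R R x f).
  exact: solution_path_continuous.
exact: fc.
Qed.

Lemma drift_path_integrable s t : 0 <= s ->
  lebesgue_measure.-integrable `[s, t] (EFin \o (f \o x)).
Proof.
move=> s0; apply: continuous_compact_integrable; first exact: segment_compact.
exact: drift_path_continuous.
Qed.

Lemma solution_path_incr s t : 0 <= s -> s <= t ->
  x t - x s = \int[lebesgue_measure]_(u in `[s, t]) f (x u) + sigma * (b t - b s).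
Proof.
move=> s0 st; rewrite (xE t) ?(le_trans s0)// (xE s)//.
have := @Rintegral_itvB R (f \o x) (BLeft 0) (BRight t) s.
rewrite !bnd_simp => /(_ (drift_path_integrable 0 t (lexx _)) s0 st).
rewrite Rintegral_itv_obnd_cbnd => [<- /=|]; first by ring.
by apply: integrableS (drift_path_integrable s t s0) => //; exact: subset_itv_oc_cc.
Qed.

(** The noise being additive, its contribution cancels exactly and only the oscillation of the drift
    along the path over [[s, t]] remains. *)
Lemma euler_local_error s t e : 0 <= s -> s <= t ->
  (forall u, s <= u <= t -> `|f (x u) - f (x s)| <= e) ->
  `|x t - x s - (t - s) * f (x s) - sigma * (b t - b s)| <= (t - s) * e.
Proof.
move=> s0 st fe; rewrite solution_path_incr//.
have icst c : lebesgue_measure.-integrable `[s, t] (EFin \o @cst _ R c).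
  apply: continuous_compact_integrable; first exact: segment_compact.
  by apply: continuous_subspaceT => ?; exact: cvg_cst.
have cstE c : \int[lebesgue_measure]_(u in `[s, t]) (@cst _ R c u) = (t - s) * c.
  rewrite Rintegral_cst//= lebesgue_measure_itv/= lte_fin.
  by case: ltgtP st => //= [_|->]; rewrite ?subrr ?mulr0 ?mul0r// mulrC.
have cancel I c d : I + c - d - c = I - d :> R by ring.
rewrite cancel -(cstE (f (x s))).
rewrite -RintegralB//; last exact: drift_path_integrable.
have iB : lebesgue_measure.-integrable `[s, t]
    (EFin \o (fun u => f (x u) - cst (f (x s)) u)).
  by apply: (integrableB _ (drift_path_integrable s t s0) (icst _)).
rewrite (le_trans (le_normr_Rintegral _ iB))// -(cstE e).
by apply: le_Rintegral => //; exact: integrable_norm.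
Qed.

End solution_path.

Section euler_scheme.
Context {R : realType} (f : R -> R) (sigma : R).

(* The state is (initial position, current position, accumulated noise). *)
Definition euler_step (h : R) (s : R * R * R) (v : R) : R * R * R :=
  (s.1.1, s.1.2 + h * f s.1.2 + sigma * v, s.2 + v).

Fixpoint euler_state (h x0 : R) (v : nat -> R) (j : nat) : R * R * R :=
  if j is i.+1 then euler_step h (euler_state h x0 v i) (v i) else (x0, x0, 0).

Definition grid (t0 h : R) (y : R -> R) (j : nat) : R := y (t0 + j%:R * h).

Lemma euler_state_fst h x0 v j : (euler_state h x0 v j).1.1 = x0.
Proof. by elim: j. Qed.

(** The increments telescope, so this component carries no discretisation error. *)
Lemma euler_state_noise t0 h x0 b j :
  (euler_state h x0 (incr (grid t0 h b)) j).2 = b (t0 + j%:R * h) - b t0.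
Proof.
elim: j => [|j IH] /=; first by rewrite mul0r addr0 subrr.
by rewrite IH /incr /grid addrC addrA subrK.
Qed.

(** A statement about one fixed path. The path over [[t0, t0 + delta]] has compact range, which
    provides a Lipschitz constant [L] valid within distance [L^-1] of it; uniform continuity of
    [f \o x] makes each local error at most [h * e], and the Gronwall bound keeps the scheme inside
    this tube. *)
Lemma euler_state_cvg (x b : R -> R) (t0 delta : R) :
  [locally [lipschitz f x | x in setT]] ->
  {within `[0, +oo[, continuous x} ->
  (forall t, 0 <= t ->
    x t = x 0 + \int[lebesgue_measure]_(s in `[0, t]) f (x s) + sigma * b t) ->
  0 <= t0 -> 0 < delta ->
  (euler_state (delta / k.+1%:R) (x t0)
     (incr (grid t0 (delta / k.+1%:R) b)) k.+1).1.2 @[k --> \oo]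
    --> x (t0 + delta).
Proof.
move=> flip xc xE t00 delta0.
have fc := locally_lipschitz_continuous _ flip.
pose K := `[t0, t0 + delta]%classic.
have Kc : compact K by exact: segment_compact.
have [L L0 fL] : exists2 L, 0 < L & forall t z, K t -> `|z - x t| <= L^-1 ->
    `|f z - f (x t)| <= L * `|z - x t|.
  have xKc : compact (x @` K).
    by apply: continuous_compact => //; exact: solution_path_continuous.
  have [L L0 fL] := locally_lipschitz_compact _ _ flip xKc.
  by exists L => // t z Kt; apply: fL; exists t.
apply/cvgrPdist_le => eps eps0.
pose C := delta * expR (delta * L).
have C0 : 0 < C by rewrite mulr_gt0// expR_gt0.
(* Chosen so that the Gronwall bound at the last step equals [Num.min L^-1 eps]: the first term
   keeps the scheme in the tube, the second is the accuracy sought. *)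
pose e := Num.min L^-1 eps / C.
have e0 : 0 < e by rewrite divr_gt0// lt_min invr_gt0 L0.
have [eta eta0 fx_unif] := compact_uniform_continuity _ _ Kc
  (drift_path_continuous f x fc xc t0 (t0 + delta) t00) _ e0.
near=> k.
set h := delta / k.+1%:R.
have h0 : 0 < h by rewrite divr_gt0.
have h_eta : h <= eta.
  rewrite ler_pdivrMr// -ler_pdivrMl// mulrC.
  rewrite (@le_trans _ _ k%:R) ?ler_nat//; near: k; exact: nbhs_infty_ger.
have nh : k.+1%:R * h = delta by rewrite mulrCA divff ?mulr1// pnatr_eq0.
pose y := euler_state h (x t0) (incr (grid t0 h b)).
pose a j := `|(y j).1.2 - x (t0 + j%:R * h)|.
have eC : e * delta * expR (delta * L) = Num.min L^-1 eps.
  by rewrite -mulrA divfK// gt_eqF.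
have := @discrete_gronwall _ a h L e k.+1 (ltW h0) (ltW L0) (ltW e0).
rewrite nh eC ge_min lexx /a /= mul0r addr0 subrr normr0 => /(_ (lexx _) isT).
move=> gronwall; rewrite distrC.
have -> : x (t0 + delta) = x (t0 + k.+1%:R * h) by rewrite nh.
rewrite (le_trans (gronwall _ k.+1 (leqnn _)))//; last first.
  by rewrite nh eC ge_min lexx orbT.
move=> j jk yL.
set t := t0 + j%:R * h in yL *.
have tS : t0 + j.+1%:R * h = t + h by rewrite /t -natr1; ring.
have tj : t0 <= t by rewrite lerDl mulr_ge0// ltW.
have tSd : t + h <= t0 + delta.
  by rewrite -tS lerD2l -nh ler_wpM2r ?ler_nat// ltW.
have Kt : K t by rewrite /K/= in_itv/= tj (le_trans _ tSd)// lerDl ltW.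
have loc : `|x (t + h) - x t - h * f (x t) - sigma * (b (t + h) - b t)| <= h * e.
  have th : t + h - t = h by ring.
  rewrite -[in leRHS]th -[X in X * f _]th.
  apply: (euler_local_error f sigma x b fc xc xE) => [||u /andP[tu ut]].
  - exact: le_trans tj.
  - by rewrite lerDl ltW.
  - apply: fx_unif => //.
      by rewrite /K/= in_itv/= (le_trans tj)// (le_trans ut).
    by rewrite ger0_norm ?subr_ge0// (le_trans _ h_eta)// lerBlDl.
rewrite tS -/y.
(* The new error is the old one transported by one Euler step, minus the local error of the exact
   path. *)
have -> : (y j).1.2 + h * f (y j).1.2 + sigma * incr (grid t0 h b) j - x (t + h) =
    ((y j).1.2 - x t) + h * (f (y j).1.2 - f (x t))
    - (x (t + h) - x t - h * f (x t) - sigma * (b (t + h) - b t)).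
  by rewrite /incr /grid tS -/t; ring.
rewrite (le_trans (ler_normB _ _))// lerD//.
rewrite (le_trans (ler_normD _ _))// mulrDl mul1r lerD2l normrM gtr0_norm//.
by rewrite -mulrA ler_wpM2l ?(ltW h0)// fL.
Unshelve. all: end_near. Qed.

End euler_scheme.

(** * Uniqueness of the one-step law *)

Section same_law.
Context {R : realType} {d : measure_display} {Omega : measurableType d}.
Variable P : probability Omega R.

Definition same_law {d' : measure_display} {T : measurableType d'}
    (Y Z : Omega -> T) : Prop :=
  forall A, measurable A -> P (Y @^-1` A) = P (Z @^-1` A).

Lemma same_law_comp {d1 d2 : measure_display} {T1 : measurableType d1}
    {T2 : measurableType d2} (g : T1 -> T2) (Y Z : Omega -> T1) :
  measurable_fun setT g -> same_law Y Z -> same_law (g \o Y) (g \o Z).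
Proof.
move=> mg YZ A mA; apply: (YZ (g @^-1` A)).
by rewrite -[X in measurable X]setTI; exact: mg.
Qed.

Lemma same_law_integral {d' : measure_display} {T : measurableType d'}
    (Y Z : Omega -> T) (g : T -> \bar R) :
  measurable_fun setT Y -> measurable_fun setT Z -> same_law Y Z ->
  measurable_fun setT g -> (forall t, 0 <= g t)%E ->
  (\int[P]_w g (Y w) = \int[P]_w g (Z w))%E.
Proof.
move=> mY mZ YZ mg g0.
pose Y' : {mfun Omega >-> T} := HB.pack Y (isMeasurableFun.Build _ _ _ _ Y mY).
pose Z' : {mfun Omega >-> T} := HB.pack Z (isMeasurableFun.Build _ _ _ _ Z mZ).
transitivity (\int[distribution P Y']_t g t)%E.
  by rewrite ge0_integral_pushforward// => ? _; exact: g0.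
transitivity (\int[distribution P Z']_t g t)%E.
  by apply: eq_measure_integral => A mA _; exact: YZ.
by rewrite ge0_integral_pushforward// => ? _; exact: g0.
Qed.

(** Rectangles form a pi-system generating the product sigma-algebra, and on them independence
    expresses both joint laws through the marginals. *)
Lemma same_law_pair {d1 d2 : measure_display} {T1 : measurableType d1}
    {T2 : measurableType d2} (Y Y' : Omega -> T1) (V V' : Omega -> T2) :
  measurable_fun setT Y -> measurable_fun setT Y' ->
  measurable_fun setT V -> measurable_fun setT V' ->
  (forall A U, measurable A -> measurable U ->
    P (Y @^-1` A `&` V @^-1` U) = (P (Y @^-1` A) * P (V @^-1` U))%E) ->
  (forall A U, measurable A -> measurable U ->
    P (Y' @^-1` A `&` V' @^-1` U) = (P (Y' @^-1` A) * P (V' @^-1` U))%E) ->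
  same_law Y Y' -> same_law V V' ->
  same_law (fun w => (Y w, V w)) (fun w => (Y' w, V' w)).
Proof.
move=> mY mY' mV mV' YV YV' YY' VV' W mW.
have mp := measurable_fun_pair mY mV; have mp' := measurable_fun_pair mY' mV'.
pose p : {mfun Omega >-> (T1 * T2)%type} := HB.pack (fun w => (Y w, V w))
  (isMeasurableFun.Build _ _ _ _ _ mp).
pose p' : {mfun Omega >-> (T1 * T2)%type} := HB.pack (fun w => (Y' w, V' w))
  (isMeasurableFun.Build _ _ _ _ _ mp').
pose G := [set A `*` B | A in @measurable _ T1 & B in @measurable _ T2].
apply: (@measure_unique _ R _ G (fun=> setT) _ _ _ _
    (distribution P p) (distribution P p')) => //=.
- exact: measurable_prod_measurableType.
- move=> _ _ [A1 mA1 [B1 mB1 <-]] [A2 mA2 [B2 mB2 <-]].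
  exists (A1 `&` A2); first exact: measurableI.
  by exists (B1 `&` B2); [exact: measurableI|rewrite setXI].
- by move=> _; exists setT => //; exists setT => //; rewrite setXTT.
- by rewrite bigcup_const.
- move=> _ [A mA [U mU <-]]; rewrite /distribution /pushforward.
  by rewrite (YV _ _ mA mU) (YV' _ _ mA mU) YY'// VV'.
- by move=> _; rewrite probability_setT ltry.
Qed.

End same_law.

(** * Measurability with respect to a filtration *)

Section adapted_measurability.
Context {R : realType} {d : measure_display} {Omega : measurableType d}.

(** Turns adaptedness into measurability on a measurable type carrying the sub-sigma-algebra, where
    the closure lemmas for measurable functions apply. *)
Lemma measurable_g_sigma_algebraP {d' : measure_display} {T : measurableType d'}
    (G : set (set Omega)) (Y : Omega -> T) : sigma_algebra setT G ->
  measurable_fun (setT : set (g_sigma_algebraType G)) Y <->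
  forall A, measurable A -> G (Y @^-1` A).
Proof.
move=> sG; have mG := measurable_g_measurableTypeE sG; split=> [mY A mA|GY _ A mA].
  by rewrite -mG -[X in measurable X]setTI; exact: mY.
by rewrite setTI mG; exact: GY.
Qed.

Lemma filtration_measurable_fun (Fil : R -> set (set Omega)) (t : R)
    {d' : measure_display} {T : measurableType d'} (Y : Omega -> T) :
  filtration Fil -> 0 <= t -> (forall A, measurable A -> Fil t (Y @^-1` A)) ->
  measurable_fun setT Y.
Proof.
move=> FF t0 FY _ A mA; rewrite setTI.
by apply: (filtration_measurable FF t0); exact: FY.
Qed.

End adapted_measurability.

(** * The law of the Euler scheme *)

Section euler_law.
Context {R : realType} {d : measure_display} {Omega : measurableType d}.
Variables (P : probability Omega R) (f : R -> R) (sigma : R).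
Hypothesis fc : continuous f.

Definition euler_process (h t0 : R) (X B : R -> Omega -> R) (j : nat) (w : Omega) :=
  euler_state f sigma h (X t0 w) (incr (grid t0 h (B ^~ w))) j.

Lemma measurable_euler_step h :
  measurable_fun setT (fun p : (R * R * R) * R => euler_step f sigma h p.1 p.2).
Proof.
have mf : measurable_fun setT f by exact: continuous_measurable_fun.
rewrite /euler_step.
apply: measurable_fun_pair; first apply: measurable_fun_pair.
- by do 2 apply: measurableT_comp => //.
- apply: measurable_funD; [apply: measurable_funD|].
  + by do 2 apply: measurableT_comp => //.
  + apply: measurable_funM => //; apply: (measurableT_comp mf).
    by do 2 apply: measurableT_comp => //.
  + exact: measurable_funM.
- by apply: measurable_funD => //; exact: measurableT_comp.
Qed.

(** This is what makes the next noise increment independent of the current state, through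
    [bm_indep]. *)
Lemma euler_process_adapted Fil h t0 X B : filtration Fil ->
  adapted Fil X -> adapted Fil B -> 0 <= t0 -> 0 <= h ->
  forall j A, measurable A -> Fil (t0 + j%:R * h) (euler_process h t0 X B j @^-1` A).
Proof.
move=> FF FX FB t00 h0.
have tj0 j : 0 <= t0 + j%:R * h by rewrite addr_ge0// mulr_ge0.
have sF j := filtration_sigma FF (tj0 j).
elim=> [|j IH] A mA.
  rewrite mul0r addr0; apply: (measurable_g_sigma_algebraP _ _ _).1 A mA.
    exact: filtration_sigma.
  have mX : measurable_fun (setT : set (g_sigma_algebraType (Fil t0))) (X t0).
    apply/measurable_g_sigma_algebraP; first exact: filtration_sigma.
    by move=> U mU; exact: FX.
  by apply: measurable_fun_pair => //; exact: measurable_fun_pair.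
set t := t0 + j%:R * h in IH *; set t' := t0 + j.+1%:R * h.
have tt' : t <= t' by rewrite lerD2l ler_wpM2r// ler_nat.
apply: (measurable_g_sigma_algebraP _ _ (sF j.+1)).1 A mA.
set T' := g_sigma_algebraType _.
have mZ : measurable_fun (setT : set T') (euler_process h t0 X B j).
  apply/measurable_g_sigma_algebraP => // U mU.
  by apply: (filtration_mono FF (tj0 j) tt'); exact: IH.
have mBt : measurable_fun (setT : set T') (B t).
  apply/measurable_g_sigma_algebraP => // U mU.
  by apply: (filtration_mono FF (tj0 j) tt'); apply: FB => //; exact: tj0.
have mBt' : measurable_fun (setT : set T') (B t').
  apply/measurable_g_sigma_algebraP => // U mU.
  by apply: FB => //; exact: tj0.
rewrite (_ : euler_process _ _ _ _ _ =
  (fun p => euler_step f sigma h p.1 p.2) \o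
  (fun w => (euler_process h t0 X B j w, incr (grid t0 h (B ^~ w)) j)))//.
apply: measurableT_comp; first exact: measurable_euler_step.
by apply: measurable_fun_pair => //; exact: measurable_funB.
Qed.

(** By induction on [j]: in each system the next increment is independent of the current state and
    is a centred Gaussian of variance [h], so the joint laws of state and increment agree, and so do
    their images under [euler_step]. *)
Lemma euler_process_same_law Fil Fil' h t0 t0' X B X' B' :
  filtration Fil -> filtration Fil' ->
  brownian_motion P Fil B -> brownian_motion P Fil' B' ->
  adapted Fil X -> adapted Fil' X' ->
  0 <= t0 -> 0 <= t0' -> 0 < h -> same_law P (X t0) (X' t0') ->
  forall j, same_law P (euler_process h t0 X B j) (euler_process h t0' X' B' j).
Proof.
move=> FF FF' bB bB' FX FX' t00 t00' h0 XX'; have h_ge0 := ltW h0.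
have adp := euler_process_adapted _ h t0 X B FF FX (bm_adapted bB) t00 h_ge0.
have adp' :=
  euler_process_adapted _ h t0' X' B' FF' FX' (bm_adapted bB') t00' h_ge0.
elim=> [|j IH].
  apply: (same_law_comp P (fun x : R => (x, x, 0 : R))) => //.
  by apply: measurable_fun_pair => //; exact: measurable_fun_pair.
have tj0 s : 0 <= s -> 0 <= s + j%:R * h by move=> s0; rewrite addr_ge0// mulr_ge0.
have dt s : s + j.+1%:R * h - (s + j%:R * h) = h by rewrite -natr1; ring.
have tj s : s + j%:R * h < s + j.+1%:R * h by rewrite -subr_gt0 dt.
have [mV lawV] := bm_law bB (tj0 _ t00) (tj t0).
have [mV' lawV'] := bm_law bB' (tj0 _ t00') (tj t0').
apply: (same_law_comp P (fun p : (R * R * R) * R => euler_step f sigma h p.1 p.2)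
  (fun w => (euler_process h t0 X B j w, incr (grid t0 h (B ^~ w)) j))
  (fun w => (euler_process h t0' X' B' j w, incr (grid t0' h (B' ^~ w)) j))).
  exact: measurable_euler_step.
apply: same_law_pair => //.
- by apply: (filtration_measurable_fun Fil _ _ FF (tj0 _ t00)); exact: adp.
- by apply: (filtration_measurable_fun Fil' _ _ FF' (tj0 _ t00')); exact: adp'.
- move=> A U mA mU; apply: (bm_indep bB) => //; first exact: tj0.
    exact: ltW.
  exact: adp.
- move=> A U mA mU; apply: (bm_indep bB') => //; first exact: tj0.
    exact: ltW.
  exact: adp'.
- by move=> U mU; rewrite (lawV _ mU) (lawV' _ mU) !dt.
Qed.

End euler_law.

(** * Passage to the limit: the law over one step of the exact solution *)

Section one_step_law.
Context {R : realType} {d : measure_display} {Omega : measurableType d}.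
Variables (P : probability Omega R) (f : R -> R) (sigma : R).
Hypothesis flip : [locally [lipschitz f x | x in setT]].

(** Ordered like the Euler state, of which it is the almost sure limit as the number of substeps
    grows. *)
Definition one_step (delta t0 : R) (X B : R -> Omega -> R) (w : Omega) : R * R * R :=
  (X t0 w, X (t0 + delta) w, B (t0 + delta) w - B t0 w).

Lemma sde_solution_measurable X B t : sde_solution P f sigma X B -> 0 <= t ->
  measurable_fun setT (X t) /\ measurable_fun setT (B t).
Proof.
move=> [Fil [FF bB FX _ _]] t0; split; apply: (filtration_measurable_fun Fil t) => //.
  by move=> A mA; exact: FX.
by move=> A mA; exact: (bm_adapted bB).
Qed.

Lemma one_step_measurable delta t0 X B : sde_solution P f sigma X B ->
  0 <= t0 -> 0 < delta -> measurable_fun setT (one_step delta t0 X B).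
Proof.
move=> sol t00 delta0; have td0 : 0 <= t0 + delta by rewrite addr_ge0// ltW.
have [mX mB] := sde_solution_measurable _ _ _ sol t00.
have [mXd mBd] := sde_solution_measurable _ _ _ sol td0.
by apply: measurable_fun_pair; [exact: measurable_fun_pair|exact: measurable_funB].
Qed.

(** Dominated convergence. Continuity of [G] in its middle argument suffices, because the initial
    position and the accumulated noise of the Euler state already equal those of the limit for every
    [k]. This matters as flow maps are only measurable. *)
Lemma euler_process_cvg_integral (G : R * R * R -> R) (c delta t0 : R) X B :
  sde_solution P f sigma X B -> 0 <= t0 -> 0 < delta ->
  measurable_fun setT G -> (forall z, 0 <= G z <= c) ->
  (forall x v, continuous (fun y => G (x, y, v))) ->
  (\int[P]_w (G (euler_process f sigma (delta / k.+1%:R) t0 X B k.+1 w))%:E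
     @[k --> \oo] --> \int[P]_w (G (one_step delta t0 X B w))%:E)%E.
Proof.
move=> sol t00 delta0 mG G0c Gc.
have fc := locally_lipschitz_continuous _ flip.
have mS := one_step_measurable _ _ _ _ sol t00 delta0.
have [Fil [FF bB FX Xc XE]] := sol.
have kd k : k.+1%:R * (delta / k.+1%:R) = delta.
  by rewrite mulrCA divff ?mulr1// pnatr_eq0.
have mZ k : measurable_fun setT (euler_process f sigma (delta / k.+1%:R) t0 X B k.+1).
  apply: (filtration_measurable_fun Fil (t0 + k.+1%:R * (delta / k.+1%:R))) => //.
    by rewrite kd addr_ge0// ltW.
  apply: euler_process_adapted => //; first exact: (bm_adapted bB).
  by rewrite divr_ge0// ltW.
have [] // := @dominated_convergence _ _ R P setT measurableT
  (fun k w => (G (euler_process f sigma (delta / k.+1%:R) t0 X B k.+1 w))%:E)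
  (fun w => (G (one_step delta t0 X B w))%:E) (EFin \o cst c).
- by move=> k; apply/measurable_EFinP; exact: measurableT_comp.
- by apply/measurable_EFinP; exact: measurableT_comp.
- apply: filterS2 Xc XE => w Xcw XEw _.
  apply: cvg_EFin; first exact: nearW.
  have := euler_state_cvg f sigma (X ^~ w) (B ^~ w) t0 delta flip Xcw XEw t00 delta0.
  move=> /(continuous_cvg _ (Gc (X t0 w) (B (t0 + delta) w - B t0 w) _)).
  apply: cvg_trans; apply: near_eq_cvg; apply: nearW => k.
  rewrite /euler_process; congr (G _).
  have := euler_state_noise f sigma t0 (delta / k.+1%:R) (X t0 w) (B ^~ w) k.+1.
  have := euler_state_fst f sigma (delta / k.+1%:R) (X t0 w)
    (incr (grid t0 (delta / k.+1%:R) (B ^~ w))) k.+1.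
  by rewrite kd; case: euler_state => [[a b] e] /= -> ->.
- exact: finite_measure_integrable_cst.
- apply: aeW => w k _ /=.
  have /andP[G0 Gc'] :=
    G0c (euler_process f sigma (delta / k.+1%:R) t0 X B k.+1 w).
  by rewrite ger0_norm// lee_fin.
Qed.

Lemma one_step_integral_eq (G : R * R * R -> R) (delta t0 t0' : R) X B X' B' :
  sde_solution P f sigma X B -> sde_solution P f sigma X' B' ->
  0 <= t0 -> 0 <= t0' -> 0 < delta -> same_law P (X t0) (X' t0') ->
  measurable_fun setT G -> (forall z, 0 <= G z) ->
  (forall x v, continuous (fun y => G (x, y, v))) ->
  (\int[P]_w (G (one_step delta t0 X B w))%:E
   = \int[P]_w (G (one_step delta t0' X' B' w))%:E)%E.
Proof.
move=> sol sol' t00 t00' delta0 XX' mG G0 Gc.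
(* Truncation makes the integrand bounded; monotone convergence in [c] then recovers [G], even when
   its integral is infinite. *)
pose H (c : nat) z := Num.min (G z) c%:R.
have mH c : measurable_fun setT (H c) by apply: measurable_minr.
have H0 c z : 0 <= H c z by rewrite le_min G0 ler0n.
(* Both truncated integrals are limits of Euler integrals, and these coincide for every [k] by
   equality of laws. *)
have HE c : (\int[P]_w (H c (one_step delta t0 X B w))%:E
   = \int[P]_w (H c (one_step delta t0' X' B' w))%:E)%E.
  have H0c z : 0 <= H c z <= c%:R by rewrite H0 ge_min lexx orbT.
  have Hc x v : continuous (fun y => H c (x, y, v)).
    move=> y; apply: (@continuous_min _ _ (fun y => G (x, y, v)) (cst c%:R)).
      exact: Gc.
    exact: cvg_cst.
  have cv := euler_process_cvg_integral _ _ _ _ _ _ sol t00 delta0 (mH c) H0c Hc.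
  have cv' := euler_process_cvg_integral _ _ _ _ _ _ sol' t00' delta0 (mH c) H0c Hc.
  apply: (cvg_unique _ cv); first exact: ereal_hausdorff.
  apply: cvg_trans cv'; apply: near_eq_cvg; apply: nearW => k /=.
  have [Fil [FF bB FX _ _]] := sol.
  have [Fil' [FF' bB' FX' _ _]] := sol'.
  have h0 : 0 < delta / k.+1%:R by rewrite divr_gt0.
  have fc := locally_lipschitz_continuous _ flip.
  apply: (same_law_integral P _ _ (fun z => (H c z)%:E)).
  - apply: (filtration_measurable_fun Fil' (t0' + k.+1%:R * (delta / k.+1%:R))) => //.
      by rewrite addr_ge0// mulr_ge0// ltW.
    by apply: euler_process_adapted => //; [exact: (bm_adapted bB')|exact: ltW].
  - apply: (filtration_measurable_fun Fil (t0 + k.+1%:R * (delta / k.+1%:R))) => //.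
      by rewrite addr_ge0// mulr_ge0// ltW.
    by apply: euler_process_adapted => //; [exact: (bm_adapted bB)|exact: ltW].
  - by move=> A mA; apply/esym; move: A mA;
      apply: (euler_process_same_law P f sigma fc Fil Fil').
  - exact/measurable_EFinP.
  - by move=> z; rewrite lee_fin.
have Hcvg z : (H c z)%:E @[c --> \oo] --> (G z)%:E.
  apply: cvg_near_cst; near=> c; congr (_%:E); apply/min_idPl.
  by near: c; exact: nbhs_infty_ger.
have Hmono Y B0 t : sde_solution P f sigma Y B0 -> 0 <= t ->
    (\int[P]_w (H c (one_step delta t Y B0 w))%:E @[c --> \oo]
      --> \int[P]_w (G (one_step delta t Y B0 w))%:E)%E.
  move=> solY t_ge0; have mS := one_step_measurable _ _ _ _ solY t_ge0 delta0.
  have := @cvg_monotone_convergence _ Omega R P setT measurableT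
    (fun c w => (H c (one_step delta t Y B0 w))%:E).
  have -> : (fun w => limn (fun c => (H c (one_step delta t Y B0 w))%:E)) =
      (fun w => (G (one_step delta t Y B0 w))%:E).
    by apply/funext => w; exact/cvg_lim.
  apply.
  - by move=> c; apply/measurable_EFinP; exact: measurableT_comp.
  - by move=> c w _; rewrite lee_fin.
  - by move=> w _ c c' cc'; rewrite lee_fin /H le_min !ge_min lexx/= ler_nat cc' orbT.
apply: (cvg_unique _ (Hmono _ _ _ sol t00)); first exact: ereal_hausdorff.
apply: cvg_trans (Hmono _ _ _ sol' t00'); apply: near_eq_cvg.
by apply: nearW => c; rewrite /= HE.
Unshelve. all: end_near. Qed.
End one_step_law.

(** * Least squares and the mean residual *)

(** Pythagoras: the residual for [c] is the residual [r] for [chat] plus a combination [u] of the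
    basis vectors, and [r] is orthogonal to [u]. *)
Lemma normal_equations_least_squares {R : realDomainType} {I J : finType}
    (y : I -> R) (phi : J -> I -> R) (chat c : J -> R) :
  (forall j, \sum_i (y i - \sum_k chat k * phi k i) * phi j i = 0) ->
  \sum_i (y i - \sum_k chat k * phi k i) ^+ 2
    <= \sum_i (y i - \sum_k c k * phi k i) ^+ 2.
Proof.
move=> orth; pose r i := y i - \sum_k chat k * phi k i.
pose u i := \sum_k (chat k - c k) * phi k i.
have ru0 : \sum_i r i * u i = 0.
  rewrite (eq_bigr (fun i => \sum_k (chat k - c k) * (r i * phi k i))).
    rewrite exchange_big big1// => k _.
    by rewrite -mulr_sumr orth mulr0.
  by move=> i _; rewrite mulr_sumr; apply: eq_bigr => k _; rewrite mulrCA.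
rewrite (eq_bigr (fun i => (r i ^+ 2 + u i ^+ 2) + (r i * u i) *+ 2)
  (P := xpredT) (F1 := fun i => (y i - \sum_k c k * phi k i) ^+ 2)); last first.
  move=> i _; rewrite -(_ : r i + u i = y i - \sum_k c k * phi k i).
    by rewrite sqrrD addrAC.
  rewrite /r /u; under [X in _ + X]eq_bigr do rewrite mulrBl.
  by rewrite sumrB; ring.
rewrite big_split/= sumrMnl ru0 mul0rn addr0 big_split/= lerDl.
by apply: sumr_ge0 => i _; exact: sqr_ge0.
Qed.

Lemma pseudo_inverse_unit {R : realType} (n : nat) (A : 'M[R]_n) :
  A \in unitmx -> A *m pseudo_inverse A = 1%:M.
Proof.
move=> uA; have [AGA _ _ _] : is_pseudo_inverse A (pseudo_inverse A).
  (* The inverse satisfies the four conditions, so [xget] returns a solution of them and not its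
     default [0]. The first condition alone then gives the conclusion. *)
  apply: xgetPex; exists (invmx A).
  by split; rewrite ?mulmxV ?mulVmx ?mul1mx ?trmx1.
by rewrite -[LHS](mulmxK uA) AGA mulmxV.
Qed.

Lemma sigma2_hat_le {R : realType} {p : nat} (phi : 'I_p.+1 -> R -> R -> R)
    (delta : R) (N M : nat) (x b : 'I_M -> nat -> R) (c : 'cV[R]_p.+1) :
  delta != 0 -> (0 < N)%N -> (0 < M)%N -> normal_matrix phi N x b \in unitmx ->
  sigma2_hat phi delta N x b <= 2 * (M * N)%:R^-1 * \sum_(m < M) \sum_(n < N)
    `| incr (x m) n / delta - param_flow phi c (x m n) (incr (b m) n) | ^+ 2.
Proof.
move=> delta0 N0 M0 uA; rewrite /sigma2_hat.
set chat := estimator phi delta N x b.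
pose res (c' : 'cV[R]_p.+1) m n := incr (x m) n / delta
  - param_flow phi c' (x m n) (incr (b m) n).
(* In terms of flow maps the error is divided by [delta]; the resulting [delta ^+ 2] cancels the
   normalisation of [sigma2_hat]. *)
have -> : \sum_(m < M) \sum_(n < N) `| incr (x m) n - delta *
      param_flow phi chat (x m n) (incr (b m) n) | ^+ 2 =
    delta ^+ 2 * \sum_(m < M) \sum_(n < N) res chat m n ^+ 2.
  rewrite mulr_sumr; apply: eq_bigr => m _; rewrite mulr_sumr.
  apply: eq_bigr => n _; rewrite real_normK ?num_real// -exprMn /res mulrBr.
  by rewrite mulrCA divff// mulr1.
have scale (K S : R) : 2 / delta ^+ 2 * K * (delta ^+ 2 * S) = 2 * K * S by field.
rewrite scale.
rewrite ler_wpM2l ?mulr_ge0 ?invr_ge0//.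
under [leRHS]eq_bigr do under eq_bigr do rewrite real_normK ?num_real//.
rewrite !pair_bigA/=.
apply: (normal_equations_least_squares
  (fun k : 'I_M * 'I_N => incr (x k.1) k.2 / delta)
  (fun i k => phi i (x k.1 k.2) (incr (b k.1) k.2))
  (fun i => chat i 0) (fun i => c i 0)) => i.
have MN0 : (M * N)%:R != 0 :> R by rewrite pnatr_eq0 -lt0n muln_gt0 M0.
have : (normal_matrix phi N x b *m chat) i 0 = normal_vector phi delta N x b i 0.
  by rewrite /chat /estimator mulmxA pseudo_inverse_unit// mul1mx.
rewrite !mxE => eqi.
under eq_bigr do rewrite mulrBl.
rewrite sumrB; apply/eqP; rewrite subr_eq0 eq_sym; apply/eqP.
(* Divided by the number of data points, orthogonality to the [i]-th basis function is the [i]-th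
   row of the normal equations. *)
apply: (mulfI (invr_neq0 MN0)).
transitivity (\sum_j normal_matrix phi N x b i j * chat j 0); last first.
  by rewrite eqi pair_bigA.
under [RHS]eq_bigr do rewrite mxE pair_bigA/= -mulrA mulr_suml.
rewrite -mulr_sumr exchange_big; congr (_ * _); apply: eq_bigr => k _.
by rewrite mulr_suml; apply: eq_bigr => j _; ring.
Qed.

(** * Expectation of the residual *)

Section residual.
Context {R : realType} {d : measure_display} {Omega : measurableType d}.
Variable P : probability Omega R.

Import HBNNSimple.

(* [f] is not assumed measurable: the pseudo-inverse is uncontrolled where the
   normal matrix is singular. *)
Lemma ae_le_integral (f g : Omega -> \bar R) :
  (forall w, 0 <= f w)%E -> (forall w, 0 <= g w)%E -> measurable_fun setT g ->
  {ae P, forall w, (f w <= g w)%E} -> (\int[P]_w f w <= \int[P]_w g w)%E.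
Proof.
move=> f0 g0 mg fg; rewrite ge0_integralTE//.
(* The integral of [f] is a supremum over simple functions below [f]; these are measurable and
   almost everywhere below [g]. *)
apply: ge_ereal_sup => _ [h hf <-].
rewrite -integralT_nnsfun; apply: ae_ge0_le_integral => //.
- by move=> w _; rewrite lee_fin fun_ge0.
- exact/measurable_EFinP.
- by apply: filterS fg => w fgw _; exact: le_trans (hf w) fgw.
Qed.

(** The flow map is a finite combination of basis functions, whose membership in the Lebesgue space
    includes measurability. *)
Lemma inference_flow_measurable f sigma mu X delta p (phi : 'I_p.+1 -> R -> R -> R)
    F N M (Xs Bs : 'I_M -> R -> Omega -> R) :
  inference_setting P f sigma mu X delta phi F N Xs Bs ->
  measurable_fun setT (fun z : R * R => F z.1 z.2).
Proof.
move=> set; have [c Fc] := setting_scheme set.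
under eq_fun do rewrite Fc.
apply: measurable_sum => i; apply: measurable_funM => //.
by have := sub_Lfun_mfun (setting_basis set i); rewrite inE.
Qed.

(** Invariance of [mu] gives the two positions the same law at their respective times, and this
    determines the law over the following step. *)
Lemma one_step_mse_stationary f sigma mu (F : R -> R -> R) delta n n' X B X' B' :
  [locally [lipschitz f x | x in setT]] -> ergodic_measure f sigma mu ->
  sde_solution P f sigma X B -> has_law P (X 0) mu ->
  sde_solution P f sigma X' B' -> has_law P (X' 0) mu ->
  0 < delta -> measurable_fun setT (fun z : R * R => F z.1 z.2) ->
  one_step_mse P delta F X B n = one_step_mse P delta F X' B' n'.
Proof.
move=> flip erg sol lawX sol' lawX' delta0 mF.
(* The end position enters only through a squared affine expression, so [G] is continuous in it
   although [F] is merely measurable. *)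
pose G (z : R * R * R) := `|(z.1.2 - z.1.1) / delta - F z.1.1 z.2| ^+ 2.
have td k : 0 <= k%:R * delta by rewrite mulr_ge0// ltW.
have mseE Y C k : one_step_mse P delta F Y C k =
    (\int[P]_w (G (one_step delta (k%:R * delta) Y C w))%:E)%E.
  rewrite /one_step_mse unlock; apply: eq_integral => w _.
  have kd : k.+1%:R * delta = k%:R * delta + delta by rewrite -natr1 mulrDl mul1r.
  by rewrite /sampled /incr kd.
rewrite !mseE; apply: (one_step_integral_eq P f sigma) => //.
- move=> A mA; have [_ ->//] := ergodic_invariant erg sol lawX (td n).
  by have [_ ->//] := ergodic_invariant erg sol' lawX' (td n').
- have mF' : measurable_fun setT (fun z : R * R * R => F z.1.1 z.2).
    apply: (measurableT_comp (f := fun z : R * R => F z.1 z.2)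
      (g := fun z : R * R * R => (z.1.1, z.2))) => //.
    by apply: measurable_fun_pair => //; exact: measurableT_comp.
  have m1 : measurable_fun setT (fun z : R * R * R => z.1.1) by exact: measurableT_comp.
  have m2 : measurable_fun setT (fun z : R * R * R => z.1.2) by exact: measurableT_comp.
  apply: measurable_funX; apply: measurableT_comp => //.
  apply: measurable_funB => //; apply: measurable_funM => //.
  exact: measurable_funB.
- by move=> z; exact: exprn_ge0.
- move=> x v y; rewrite /G /=.
  apply: (@continuous_comp _ _ _ (fun y : R => `|(y - x) / delta - F x v|)
    (fun u => u ^+ 2)); last exact: exprn_continuous.
  apply: (@continuous_comp _ _ _ (fun y : R => (y - x) / delta - F x v) (fun u => `|u|)).
    apply: cvgB; last exact: cvg_cst.
    by apply: cvgMl; apply: cvgB; [exact: cvg_id|exact: cvg_cst].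
  exact: norm_continuous.
Qed.

Lemma mean_sigma2_hat_le f sigma mu delta p (phi : 'I_p.+1 -> R -> R -> R) F N M
    X B (Xs Bs : 'I_M -> R -> Omega -> R) n :
  [locally [lipschitz f x | x in setT]] -> ergodic_measure f sigma mu ->
  sde_solution P f sigma X B -> has_law P (X 0) mu ->
  inference_setting P f sigma mu X delta phi F N Xs Bs ->
  (mean_sigma2_hat P phi delta N Xs Bs <= 2 * one_step_mse P delta F X B n)%E.
Proof.
move=> flip erg sol lawX set.
have delta0 := setting_delta set; have [N0 M0] := setting_sizes set.
have mF := inference_flow_measurable _ _ _ _ _ _ _ _ _ _ _ _ set.
have [c Fc] := setting_scheme set.
pose err m k w := `|incr (sampled delta (Xs m) w) k / delta
  - F (sampled delta (Xs m) w k) (incr (sampled delta (Bs m) w) k)| ^+ 2.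
have merr m k : measurable_fun setT (err m k).
  have td j : 0 <= j%:R * delta by rewrite mulr_ge0// ltW.
  have mX j := sde_solution_measurable _ _ _ _ _ _ (setting_solutions set m) (td j).
  rewrite /err /incr /sampled; apply: measurable_funX; apply: measurableT_comp => //.
  apply: measurable_funB.
    apply: measurable_funM => //.
    by apply: measurable_funB; [exact: (mX _).1|exact: (mX _).1].
  apply: (measurableT_comp mF (g := fun w => (Xs m (k%:R * delta) w,
    Bs m (k.+1%:R * delta) w - Bs m (k%:R * delta) w))).
  apply: measurable_fun_pair; first exact: (mX k).1.
  by apply: measurable_funB; [exact: (mX k.+1).2|exact: (mX k).2].
have err0 m k w : 0 <= err m k w by exact: exprn_ge0.
pose a : R := 2 * (M * N)%:R^-1.
have a0 : 0 <= a by rewrite mulr_ge0// invr_ge0.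
rewrite /mean_sigma2_hat unlock.
(* The intermediate term is twice the empirical mean square error of the explicit scheme. It is
   measurable, and bounds the residual wherever the normal matrix is invertible. *)
apply: (@le_trans _ _
  (\int[P]_w (a%:E * \sum_(m < M) \sum_(k < N) (err m k w)%:E))%E).
  apply: ae_le_integral => [w|w||].
  - rewrite lee_fin !mulr_ge0 ?invr_ge0 ?sqr_ge0// sumr_ge0// => m _.
    by rewrite sumr_ge0// => k _; exact: exprn_ge0.
  - rewrite mule_ge0// sume_ge0// => m _; rewrite sume_ge0// => k _.
    by rewrite lee_fin.
  - apply: measurable_funeM; apply: emeasurable_sum => m.
    by apply: emeasurable_sum => k; exact/measurable_EFinP.
  - apply: filterS (setting_unit set) => w uA.
    under [X in (_ <= _ * X)%E]eq_bigr do rewrite sumEFin.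
    rewrite sumEFin -EFinM lee_fin.
    rewrite (le_trans (sigma2_hat_le _ _ _ _ _ _ c _ N0 M0 uA)) ?gt_eqF//.
    rewrite ler_wpM2l// ler_sum// => m _; rewrite ler_sum// => k _.
    by rewrite /err Fc.
rewrite ge0_integralZl//; last 2 first.
- apply: emeasurable_sum => m; apply: emeasurable_sum => k.
  exact/measurable_EFinP.
- by move=> w _; rewrite sume_ge0// => m _; rewrite sume_ge0// => k _; rewrite lee_fin.
rewrite ge0_integral_sum//; last 2 first.
- by move=> m; apply: emeasurable_sum => k; exact/measurable_EFinP.
- by move=> m w _; rewrite sume_ge0// => k _; rewrite lee_fin.
have mseE m k : (\int[P]_w (err m k w)%:E)%E = one_step_mse P delta F X B n.
  transitivity (one_step_mse P delta F (Xs m) (Bs m) k).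
    by rewrite /one_step_mse unlock.
  apply: (one_step_mse_stationary f sigma mu) => //.
    exact: (setting_solutions set).
  exact: (setting_initial set).
under eq_bigr => m _.
  rewrite ge0_integral_sum//; last 2 first.
  - by move=> k; exact/measurable_EFinP.
  - by move=> k w _; rewrite lee_fin.
  under eq_bigr do rewrite mseE.
  over.
have e0 : (0 <= one_step_mse P delta F X B n)%E.
  by apply: expectation_ge0 => w; exact: exprn_ge0.
set e := one_step_mse _ _ _ _ _ _ in e0 *.
(* The mean square error [e] is an extended real, so the distributivity behind this identity relies
   on nonnegativity. *)
have natE k : (e *+ k)%R = (k%:R%:E * e)%E.
  elim: k => [|k IH]; first by rewrite mulr0n mul0e.
  by rewrite mulrSr IH -natr1 EFinD ge0_muleDl ?lee_fin// mul1e.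
rewrite !sumr_const !card_ord -mulrnA natE muleA -EFinM.
rewrite (_ : a * _ = 2)//.
by rewrite /a mulnC -mulrA mulVf ?mulr1// pnatr_eq0 -lt0n muln_gt0 N0 M0.
Qed.

End residual.

Theorem theorem3p6 (R : realType) (f : R -> R) (sigma : R)
    (mu : probability (measurableTypeR R) R)
    (f_lip : [locally [lipschitz f x | x in setT]]) (sigma_neq0 : sigma != 0)
    (mu_ergodic : ergodic_measure f sigma mu)
    (d : measure_display) (Omega : measurableType d) (P : probability Omega R)
    (X B : R -> Omega -> R)
    (X_solution : sde_solution P f sigma X B) (X_initial : has_law P (X 0) mu)
    (p : nat) :
  (forall (delta : R) (phi : 'I_p.+1 -> R -> R -> R) (F : R -> R -> R)
      (N M : nat) (Xs Bs : 'I_M -> R -> Omega -> R),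
    inference_setting P f sigma mu X delta phi F N Xs Bs ->
    forall n : nat,
    (mean_sigma2_hat P phi delta N Xs Bs <= 2 * one_step_mse P delta F X B n)%E)
  /\
  (forall (phi : R -> 'I_p.+1 -> R -> R -> R) (F : R -> R -> R -> R)
      (N M : R -> nat) (Xs Bs : forall delta : R, 'I_(M delta) -> R -> Omega -> R),
    (\forall delta \near (0 : R)^'+,
      inference_setting P f sigma mu X delta (phi delta) (F delta) (N delta)
        (Xs delta) (Bs delta)) ->
    forall (n : nat) (r : R),
    (exists C : R, \forall delta \near (0 : R)^'+,
      (one_step_mse P delta (F delta) X B n <= (C * delta `^ r)%:E)%E) ->
    exists C : R, \forall delta \near (0 : R)^'+,
      (mean_sigma2_hat P (phi delta) delta (N delta) (Xs delta) (Bs delta)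
        <= (C * delta `^ r)%:E)%E).
Proof.
have le_mse delta phi F N M (Xs Bs : 'I_M -> R -> Omega -> R) :
    inference_setting P f sigma mu X delta phi F N Xs Bs -> forall n : nat,
    (mean_sigma2_hat P (p := p) phi delta N Xs Bs
      <= 2 * one_step_mse P delta F X B n)%E.
  by move=> setting n; exact: (mean_sigma2_hat_le P f sigma mu).
split=> [|phi F N M Xs Bs near_setting n r [C mseC]]; first exact: le_mse.
(* The factor 2 of the residual bound is absorbed into the constant, leaving the order [r]
   unchanged. *)
exists (2 * C); apply: filterS2 near_setting mseC => delta setting mseC.
rewrite (le_trans (le_mse _ _ _ _ _ _ _ setting n))// -mulrA EFinM.
by rewrite lee_pmul2l.
Qed.
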